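(* Both pairs $(\mathfrak{k}_n^{\mathrm{I}},J_n^{\mathrm{I}})$ and $(\mathfrak{k}_n^{\mathrm{II}},J_n^{\mathrm{II}})$ are MaxN for all $n\ge1$. Moreover $\nu(\mathfrak{k}_n^{\mathrm{I}})=\nu(\mathfrak{k}_n^{\mathrm{II}})=3$ for $n\ge4$, while for $n=3$ one has $\nu(\mathfrak{k}_3^{\mathrm{I}})=3$ and $\nu(\mathfrak{k}_3^{\mathrm{II}})=2$.
   Context: Lie algebras are real, of finite positive dimension; $\nu(\mathfrak{g})$ is the nilpotency step of $\mathfrak{g}$. A complex structure on $\mathfrak{g}$ is a linear endomorphism $J:\mathfrak{g}\to\mathfrak{g}$ with $J^2=-1$ and $[JX,JY]=J[JX,Y]+J[X,JY]+[X,Y]$ for all $X,Y\in\mathfrak{g}$; $\dim_{\mathbb{C}}\mathfrak{g}=\frac12\dim_{\mathbb{R}}\mathfrak{g}$. $\mathfrak{g}^{1,0}$ is the $\sqrt{-1}$-eigenspace of $J$ acting on $\mathfrak{g}^*\otimes_{\mathbb{R}}\mathbb{C}$ by $(J\alpha)(X)=\alpha(JX)$, and $d$ is the Chevalley–Eilenberg differential, $d\alpha(X,Y)=-\alpha([X,Y])$, extended complex-linearly. Put $\mathfrak{a}_0=0$ and $\mathfrak{a}_k=\{X\in\mathfrak{g} : [X,\mathfrak{g}]\subseteq\mathfrak{a}_{k-1},\ [JX,\mathfrak{g}]\subseteq\mathfrak{a}_{k-1}\}$ for $k\ge1$. $J$ is nilpotent if $\mathfrak{a}_t=\mathfrak{g}$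 for some $t$, and then $\nu(J)$ is the smallest such $t$. $(\mathfrak{g},J)$ is MaxN if $\mathfrak{g}$ is nilpotent and $J$ is a nilpotent complex structure with $\nu(J)=\dim_{\mathbb{C}}\mathfrak{g}$. For $n\ge1$, $(\mathfrak{k}_n^{\mathrm{I}},J_n^{\mathrm{I}})$ and $(\mathfrak{k}_n^{\mathrm{II}},J_n^{\mathrm{II}})$ are the Lie algebras of real dimension $2n$ with complex structure such that the $(1,0)$-space has a basis $\{\omega^i\}_{i=1}^n$ satisfying the first $n$ of the following equations (together with their complex conjugates). In both types, $d\omega^1=0$ and $d\omega^2=\omega^1\wedge\overline{\omega}^1$. Type I: for odd $m\ge3$, $d\omega^m=\sqrt{-1}(\omega^{m-1}\wedge\overline{\omega}^1-\omega^1\wedge\overline{\omega}^{m-1})$; for even $m\ge4$, $d\omega^m=\omega^1\wedge(\omega^{m-1}+\overline{\omega}^{m-1})$. Type II: for odd $m\ge3$, $d\omega^m=\omega^1\wedge(\omega^{m-1}+\overline{\omega}^{m-1})$; for even $m\ge4$, $d\omega^m=\sqrt{-1}(\omega^{m-1}\wedge\overline{\omega}^1-\omega^1\wedge\overline{\omega}^{m-1})$. These equations satisfy $d^2=0$ and have no $(0,2)$-components, so they do define Lie algebras with complex structures. *)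

(* Defs.v *)
From HB Require Import structures.
From mathcomp Require Import all_boot all_order all_algebra.
From mathcomp Require Import complex reals ring.

Set Implicit Arguments.
Unset Strict Implicit.
Unset Printing Implicit Defensive.

Import Order.TTheory GRing.Theory Num.Theory.
Local Open Scope ring_scope.
Local Open Scope complex_scope.

HB.mixin Record Vector_isLieAlgebra (R : realType) (V : Type)
    of Vector R V := {
  lie : V -> V -> V;
  lie_linearl : forall Y : V, linear (lie^~ Y);
  lie_linearr : forall X : V, linear (lie X);
  lie_alt : forall X : V, lie X X = 0;
  lie_jacobi : forall X Y Z : V,
    lie X (lie Y Z) + lie Y (lie Z X) + lie Z (lie X Y) = 0;
  lie_dim_gt0 : (0 < \dim {:V})%N
}.

#[short(type="lieAlgType")]
HB.structure Definition LieAlgebra (R : realType) :=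
  { V of Vector_isLieAlgebra R V & Vector R V }.

Arguments lie {R s} X Y.

Section LieAlgebra.
Context {R : realType}.
Implicit Type g : lieAlgType R.

(* [U, V], spanned by the brackets of basis vectors (cf. falgebra.prodv). *)
Definition liev {g} (U V : {vspace g}) : {vspace g} :=
  <<[seq lie X Y | X <- vbasis U, Y <- vbasis V]>>%VS.

Fixpoint lower_central g (k : nat) : {vspace g} :=
  if k is k'.+1 then liev {:g} (lower_central g k') else {:g}%VS.

(* The nilpotency step of g is k. *)
Definition nilpotency_step g (k : nat) : Prop :=
  lower_central g k = 0%VS /\
  (forall j, (j < k)%N -> lower_central g j <> 0%VS).

Definition nilpotent_lie g : Prop := exists k, lower_central g k = 0%VS.

Definition complex_structure g (J : 'End(g)) : Prop :=
  (forall X, J (J X) = - X) /\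
  (forall X Y,
     lie (J X) (J Y) = J (lie (J X) Y) + J (lie X (J Y)) + lie X Y).

Definition dimC g : nat := (\dim {:g})./2.

(* X lies in the subspace a_k. *)
Fixpoint in_asc g (J : 'End(g)) (k : nat) (X : g) : Prop :=
  if k is k'.+1 then
    (forall Y, in_asc J k' (lie X Y)) /\ (forall Y, in_asc J k' (lie (J X) Y))
  else X = 0.

Definition asc_full g (J : 'End(g)) (t : nat) : Prop := forall X, in_asc J t X.

Definition nilpotent_cs g (J : 'End(g)) : Prop :=
  complex_structure J /\ exists t, asc_full J t.

(* nu(J) = t. *)
Definition cs_step g (J : 'End(g)) (t : nat) : Prop :=
  asc_full J t /\ (forall s, (s < t)%N -> ~ asc_full J s).

Definition MaxN g (J : 'End(g)) : Prop :=
  [/\ nilpotent_lie g, nilpotent_cs J & cs_step J (dimC g)].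

(* An element of g^* (x)_R C is an R-linear map g -> C: [Rcomplex R] is [R[i]]
   seen as a vector space over R. *)
Definition cform g := {linear g -> Rcomplex R}.

(* g^{1,0}: (J alpha)(X) = alpha(J X). *)
Definition g10 g (J : 'End(g)) (alpha : cform g) : Prop :=
  forall X, (alpha (J X) : R[i]) = 'i%C * alpha X.

(* omega 1, ..., omega n is a basis over C of g^{1,0}; the values of omega at
   the other indices are irrelevant. *)
Definition basis10 g (J : 'End(g)) (n : nat) (omega : nat -> cform g) : Prop :=
  [/\ forall i, (1 <= i <= n)%N -> g10 J (omega i),
      forall alpha : cform g, g10 J alpha -> exists c : nat -> R[i],
        forall X, (alpha X : R[i]) = \sum_(1 <= i < n.+1) c i * omega i X
    & forall c : nat -> R[i],
        (forall X, \sum_(1 <= i < n.+1) c i * omega i X = 0 :> R[i]) ->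
        forall i, (1 <= i <= n)%N -> c i = 0].

Definition dform g (alpha : g -> R[i]) : g -> g -> R[i] :=
  fun X Y => - alpha (lie X Y).

Definition conjf (T : Type) (alpha : T -> R[i]) : T -> R[i] :=
  fun X => (alpha X)^*%C.

(* No factor 1/2, in accordance with the normalisation of dform. *)
Definition wedge (T : Type) (alpha beta : T -> R[i]) : T -> T -> R[i] :=
  fun X Y => alpha X * beta Y - alpha Y * beta X.

Definition im_form (T : Type) (omega : nat -> T -> R[i]) (j : nat) :
    T -> T -> R[i] :=
  fun X Y => 'i%C * (wedge (omega j) (conjf (omega 1%N)) X Y
                   - wedge (omega 1%N) (conjf (omega j)) X Y).

Definition re_form (T : Type) (omega : nat -> T -> R[i]) (j : nat) :
    T -> T -> R[i] :=
  wedge (omega 1%N) (fun X => omega j X + conjf (omega j) X).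

(* The right-hand sides of the equations for d omega^m, m >= 1. *)
Definition rhsI (T : Type) (omega : nat -> T -> R[i]) (m : nat) :
    T -> T -> R[i] :=
  if m == 1%N then fun _ _ => 0
  else if m == 2%N then wedge (omega 1%N) (conjf (omega 1%N))
  else if odd m then im_form omega m.-1 else re_form omega m.-1.

Definition rhsII (T : Type) (omega : nat -> T -> R[i]) (m : nat) :
    T -> T -> R[i] :=
  if m == 1%N then fun _ _ => 0
  else if m == 2%N then wedge (omega 1%N) (conjf (omega 1%N))
  else if odd m then re_form omega m.-1 else im_form omega m.-1.

(* (g, J) is (k_n^I, J_n^I); the equations determine the pair up to
   isomorphism, and it exists by Model.kI_exists. The conjugate equations
   follow from those listed, since d commutes with conjugation. *)
Definition is_kI (n : nat) g (J : 'End(g)) : Prop :=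
  [/\ \dim {:g} = (2 * n)%N, complex_structure J
    & exists omega : nat -> cform g, basis10 J n omega /\
        forall m, (1 <= m <= n)%N ->
        forall X Y, dform (omega m) X Y = rhsI (fun i => omega i) m X Y].

Definition is_kII (n : nat) g (J : 'End(g)) : Prop :=
  [/\ \dim {:g} = (2 * n)%N, complex_structure J
    & exists omega : nat -> cform g, basis10 J n omega /\
        forall m, (1 <= m <= n)%N ->
        forall X Y, dform (omega m) X Y = rhsII (fun i => omega i) m X Y].

End LieAlgebra.

(* The pairs (k_n^I, J_n^I) and (k_n^II, J_n^II) exist: on C^n, with J the
   multiplication by 'i and omega the coordinates, the equations define a
   bracket. *)
Module Model.
Section Model.
Context {R : realType}.
Local Notation C := R[i].

Definition kspace (typeI : bool) (n : nat) : Type :=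
  ('rV[R]_n.+1 * 'rV[R]_n.+1)%type.

HB.instance Definition _ (b : bool) (n : nat) :=
  Vector.copy (kspace b n) ('rV[R]_n.+1 * 'rV[R]_n.+1)%type.

Definition rhs (b : bool) (T : Type) (omega : nat -> T -> C) :=
  if b then rhsI omega else rhsII omega.

Variables (b : bool) (n : nat).
Local Notation V := (kspace b n).

Definition kcoord (m : nat) (X : V) : C :=
  X.1 0 (inord m.-1) +i* X.2 0 (inord m.-1).

Definition kmk (f : nat -> C) : V :=
  (\row_(i < n.+1) complex.Re (f i.+1), \row_(i < n.+1) complex.Im (f i.+1)).

Definition klie (X Y : V) : V := kmk (fun m => - rhs b kcoord m X Y).

Lemma kcoord_mk f m : (1 <= m <= n.+1)%N -> kcoord m (kmk f) = f m.
Proof.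
case: m => // m /= lt_mn; rewrite /kcoord /kmk /= !mxE inordK //.
by case: (f _).
Qed.

Lemma kcoord_inj (X Y : V) :
  (forall m, (1 <= m <= n.+1)%N -> kcoord m X = kcoord m Y) -> X = Y.
Proof.
case: X Y => [X1 X2] [Y1 Y2] eqXY; congr (_, _);
  apply/rowP=> i; have := eqXY i.+1 (ltn_ord i);
  by rewrite /kcoord /= inord_val => -[].
Qed.

Lemma kcoord_is_linear m : linear (kcoord m : V -> Rcomplex R).
Proof.
by move=> a X Y; rewrite /kcoord /= !mxE.
Qed.

Lemma kcoordP m (a : R) (X Y : V) :
  kcoord m (a *: X + Y) = a%:C * kcoord m X + kcoord m Y.
Proof.
rewrite /kcoord /= !mxE.
by apply/eqP; rewrite eq_complex /=; apply/andP; split; apply/eqP; ring.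
Qed.

Lemma kcoord0 m : kcoord m 0 = 0.
Proof. by rewrite /kcoord /= !mxE. Qed.

Lemma kcoordD m (X Y : V) : kcoord m (X + Y) = kcoord m X + kcoord m Y.
Proof. by rewrite /kcoord /= !mxE. Qed.

Lemma kcoordN m (X : V) : kcoord m (- X) = - kcoord m X.
Proof. by rewrite /kcoord /= !mxE. Qed.

Lemma conjc_real (a : R) : (a%:C)^*%C = a%:C.
Proof. by rewrite /real_complex_def /= oppr0. Qed.

Lemma conjc_i : ('i%C : C)^*%C = - ('i%C : C).
Proof. by apply/eqP; rewrite eq_complex /= oppr0 !eqxx. Qed.

Lemma conjcD (x y : C) : (x + y)^*%C = x^*%C + y^*%C.
Proof. exact: rmorphD. Qed.

Lemma conjcN (x : C) : (- x)^*%C = - x^*%C.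
Proof. exact: rmorphN. Qed.

Lemma conjcM (x y : C) : (x * y)^*%C = x^*%C * y^*%C.
Proof. exact: rmorphM. Qed.

Lemma conjc_0 : (0 : C)^*%C = 0.
Proof. exact: rmorph0. Qed.

Definition conjE := (conjcD, conjcN, conjcM, conjc_0, conjc_i, conjcK,
  conjc_real).

Lemma rhs_linear m (a : R) (X X' Y : V) :
  rhs b kcoord m (a *: X + X') Y =
  a%:C * rhs b kcoord m X Y + rhs b kcoord m X' Y.
Proof.
rewrite /rhs /rhsI /rhsII /im_form /re_form /wedge /conjf.
by do ?[case: ifP => _]; rewrite ?kcoordP ?conjE; ring.
Qed.

Lemma rhs_antisym m (X Y : V) : rhs b kcoord m Y X = - rhs b kcoord m X Y.
Proof.
rewrite /rhs /rhsI /rhsII /im_form /re_form /wedge /conjf.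
by do ?[case: ifP => _]; ring.
Qed.

Lemma kcoord_lie m (X Y : V) : (1 <= m <= n.+1)%N ->
  kcoord m (klie X Y) = - rhs b kcoord m X Y.
Proof. exact: kcoord_mk. Qed.

Lemma klie_linearl (Y : V) : linear (klie^~ Y).
Proof.
move=> a X X'; apply: kcoord_inj => m hm.
by rewrite kcoordP !kcoord_lie // rhs_linear; ring.
Qed.

Lemma klie_antisym (X Y : V) : klie Y X = - klie X Y.
Proof.
by apply: kcoord_inj => m hm; rewrite kcoordN !kcoord_lie // rhs_antisym.
Qed.

Lemma klie_linearr (X : V) : linear (klie X).
Proof.
move=> a Y Y'; rewrite klie_antisym klie_linearl.
by rewrite (klie_antisym X Y) (klie_antisym X Y') scalerN opprD !opprK.
Qed.

Lemma klie_alt (X : V) : klie X X = 0.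
Proof.
apply: kcoord_inj => m hm; rewrite kcoord_lie // kcoord0.
rewrite /rhs /rhsI /rhsII /im_form /re_form /wedge /conjf.
by do ?[case: ifP => _]; ring.
Qed.

Lemma kcoord1_lie (X Y : V) : kcoord 1 (klie X Y) = 0.
Proof.
by rewrite kcoord_lie // /rhs; case: ifP => _; rewrite /rhsI /rhsII oppr0.
Qed.

Lemma rhs1 (X Y : V) : rhs b kcoord 1 X Y = 0.
Proof. by rewrite /rhs; case: ifP. Qed.

Lemma rhs2 (X Y : V) :
  rhs b kcoord 2 X Y = wedge (kcoord 1) (conjf (kcoord 1)) X Y.
Proof. by rewrite /rhs; case: ifP. Qed.

Lemma rhs_ge3 m (X Y : V) : rhs b kcoord m.+3 X Y =
  if b (+) odd m then im_form kcoord m.+2 X Y else re_form kcoord m.+2 X Y.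
Proof.
have E (c : bool) (T : Type) (w : nat -> T -> C) x y : rhs c w m.+3 x y =
    if c (+) odd m then im_form w m.+2 x y else re_form w m.+2 x y.
  by case: c; rewrite /rhs /rhsI /rhsII /=; case: (odd m).
exact: E.
Qed.

Lemma klie_jacobi (X Y Z : V) :
  klie X (klie Y Z) + klie Y (klie Z X) + klie Z (klie X Y) = 0.
Proof.
apply: kcoord_inj => m hm; rewrite kcoord0 !kcoordD !(kcoord_lie _ _ hm).
case: m hm => [|[|[|m]]] hm //.
- by rewrite !rhs1; ring.
- by rewrite !rhs2 /wedge /conjf !kcoord1_lie !conjE; ring.
have hm' : (1 <= m.+2 <= n.+1)%N by case/andP: hm => _ /ltnW.
have Em X' Y' : rhs b kcoord m.+2 X' Y' = if m is k.+1 then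
    (if b (+) odd k then im_form kcoord m.+1 X' Y'
     else re_form kcoord m.+1 X' Y')
  else wedge (kcoord 1) (conjf (kcoord 1)) X' Y'.
  by case: (m) => [|k]; [exact: rhs2 | exact: rhs_ge3].
rewrite !rhs_ge3 /im_form /re_form /wedge /conjf.
rewrite !kcoord1_lie !(kcoord_lie _ _ hm') !Em /im_form /re_form /wedge /conjf.
case: (m) => [|k]; last rewrite [odd k.+1]/= addbN.
  by case: ifP => _; rewrite !conjE; ring.
by case: (b (+) odd k); rewrite [~~ _]/=; rewrite !conjE; ring.
Qed.

Lemma kdim : \dim {:V} = (2 * n.+1)%N.
Proof. by rewrite dimvf mul2n -addnn; congr (_ + _)%N; apply: mul1n. Qed.

Lemma kdim_gt0 : (0 < \dim {:V})%N.
Proof. by rewrite kdim. Qed.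

HB.instance Definition _ := Vector_isLieAlgebra.Build R V
  klie_linearl klie_linearr klie_alt klie_jacobi kdim_gt0.

HB.instance Definition _ m :=
  GRing.isLinear.Build R V (Rcomplex R) _ (kcoord m) (kcoord_is_linear m).

Definition kJfun (X : V) : V := kmk (fun m => 'i%C * kcoord m X).

Lemma kJfun_is_linear : linear kJfun.
Proof.
move=> a X Y; apply: kcoord_inj => m hm.
by rewrite kcoordP !kcoord_mk // kcoordP; ring.
Qed.

HB.instance Definition _ := GRing.isLinear.Build R V V _ kJfun kJfun_is_linear.

Definition kJ : 'End(V) := linfun kJfun.

Lemma kcoord_J m (X : V) : (1 <= m <= n.+1)%N ->
  kcoord m (kJ X) = 'i%C * kcoord m X.
Proof. by move=> hm; rewrite lfunE kcoord_mk. Qed.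

Lemma mul_ii : ('i%C : C) * 'i%C = - 1.
Proof. by rewrite -expr2 sqr_i. Qed.

Lemma kJ_complex_structure : complex_structure kJ.
Proof.
split=> [X|X Y]; apply: kcoord_inj => m hm.
  by rewrite kcoordN !kcoord_J // mulrA mul_ii mulN1r.
rewrite !kcoordD !kcoord_J // !kcoord_lie //.
have h1 : (1 <= 1 <= n.+1)%N by [].
case: m hm => [|[|[|m]]] hm //.
- by rewrite !rhs1; ring.
- by rewrite !rhs2 /wedge /conjf !kcoord_J // !conjE; ring: mul_ii.
have hm' : (1 <= m.+2 <= n.+1)%N by case/andP: hm => _ /ltnW.
rewrite !rhs_ge3 /im_form /re_form /wedge /conjf !kcoord_J //.
by case: ifP => _; rewrite !conjE; ring: mul_ii.
Qed.

Definition ke (m : nat) : V := kmk (fun k => (k == m)%:R).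

Lemma kcoord_e k m : (1 <= k <= n.+1)%N -> kcoord k (ke m) = (k == m)%:R.
Proof. exact: kcoord_mk. Qed.

Lemma RcomplexZ (a : R) (x : Rcomplex R) : a *: x = a%:C * (x : C) :> C.
Proof.
case: x => x y; apply/eqP; rewrite eq_complex /=.
by apply/andP; split; apply/eqP; rewrite !mul0r ?subr0 ?addr0.
Qed.

Lemma complexRI (x : C) : x = (complex.Re x)%:C + (complex.Im x)%:C * 'i%C.
Proof.
case: x => x y; apply/eqP; rewrite eq_complex /=.
by apply/andP; split; apply/eqP; ring.
Qed.

Lemma ksum_delta (F : nat -> C) m : (1 <= m <= n.+1)%N ->
  \sum_(1 <= i < n.+2) F i * (i == m)%:R = F m.
Proof.
move=> hm; rewrite (bigD1_seq m); [|by rewrite mem_index_iota|exact: iota_uniq].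
rewrite /= eqxx mulr1 big1_seq => [|i /andP[/negPf-> _]]; last exact: mulr0.
exact: addr0.
Qed.

Lemma kdecomp (X : V) : X = \sum_(1 <= i < n.+2)
  (complex.Re (kcoord i X) *: ke i + complex.Im (kcoord i X) *: kJ (ke i)).
Proof.
apply: kcoord_inj => m hm.
rewrite (big_morph (kcoord m) (kcoordD m) (kcoord0 m)).
rewrite -[LHS](ksum_delta (fun i => kcoord i X) hm).
apply: eq_bigr => i _; rewrite kcoordP.
rewrite -[_ *: kJ _]addr0 kcoordP kcoord0 addr0 kcoord_J // !kcoord_e //.
by rewrite eq_sym [in LHS](complexRI (kcoord i X)); ring.
Qed.

Lemma kcoord_basis10 : basis10 kJ n.+1 (fun m => kcoord m).
Proof.
split=> [m hm X|alpha Halpha|c Hc m hm]; first exact: kcoord_J.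
- exists (fun m => alpha (ke m)) => X.
  rewrite {1}(kdecomp X) (raddf_sum alpha); apply: eq_bigr => i _.
  have alphaZ a Y : (alpha (a *: Y) : C) = a%:C * (alpha Y : C).
    by rewrite -RcomplexZ; apply: (linearZ_LR alpha).
  transitivity ((complex.Re (kcoord i X))%:C * (alpha (ke i) : C) +
    (complex.Im (kcoord i X))%:C * ('i%C * (alpha (ke i) : C))).
    by rewrite -Halpha -!alphaZ; apply: (raddfD alpha).
  rewrite -[RHS]/((alpha (ke i) : C) * kcoord i X).
  by rewrite [in RHS](complexRI (kcoord i X)); ring.
- rewrite -[LHS](ksum_delta c hm) -[RHS](Hc (ke m)).
  apply: eq_big_nat => i hi; congr (_ * _).
  exact/esym/kcoord_e.
Qed.

Lemma dform_kcoord m (X Y : V) : (1 <= m <= n.+1)%N ->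
  dform (kcoord m) X Y = rhs b kcoord m X Y.
Proof. by move=> hm; rewrite /dform kcoord_lie // opprK. Qed.

End Model.

Lemma kI_exists (R : realType) (n : nat) : (1 <= n)%N ->
  exists (g : lieAlgType R) (J : 'End(g)), is_kI n J.
Proof.
case: n => // n _; exists (kspace true n : lieAlgType R), (@kJ R true n).
split; [exact: kdim | exact: kJ_complex_structure | ].
exists (fun m => kcoord m); split; first exact: kcoord_basis10.
by move=> m hm X Y; apply: (dform_kcoord (b := true)).
Qed.

Lemma kII_exists (R : realType) (n : nat) : (1 <= n)%N ->
  exists (g : lieAlgType R) (J : 'End(g)), is_kII n J.
Proof.
case: n => // n _; exists (kspace false n : lieAlgType R), (@kJ R false n).
split; [exact: kdim | exact: kJ_complex_structure | ].
exists (fun m => kcoord m); split; first exact: kcoord_basis10.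
by move=> m hm X Y; apply: (dform_kcoord (b := false)).
Qed.

End Model.

(* Main.v *)
Require Import Defs.
From HB Require Import structures.
From mathcomp Require Import all_boot all_order all_algebra.
From mathcomp Require Import complex reals.
From mathcomp Require Import zify ring lra.

(** The coordinates of a vector X are the n complex numbers w 1 X, ..., w n X
    given by the coframe; they identify g with C^n, and J with multiplication
    by the imaginary unit.  Everything is read off the coordinates of a bracket.

    The coordinate w 1 kills all brackets, and for m >= 2 the coordinate
    w m [X, Y] is a real-bilinear expression in w 1 and w (m-1) alone.  It has
    one of two shapes, alternating with the parity of m: the
    imaginary shape, 2i (Re (w 1 X * conj (w (m-1) Y)) - Re (w 1 Y *
    conj (w (m-1) X))), and the real shape, which sees w (m-1) only through
    its real part.  The form at m = 2 behaves like the imaginary shape: its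
    values are purely imaginary.

    MaxN.  If the first m-1 coordinates of X vanish, so do the first m
    coordinates of [X, Y].  Conversely, bracketing X and JX with the vector Y
    whose only nonzero coordinate is w 1 Y = i recovers w m X from coordinate
    m+1 of the brackets.  So the ascending series of J loses exactly one
    coordinate at each step: a_k is cut out by the vanishing of the first n-k
    coordinates ([in_ascP]), and a_k = g exactly when k >= n.

    Nilpotency step.  On [g, g] the coordinates of index 2 and of imaginary
    shape are purely imaginary.  The real shape annihilates such a coordinate,
    and every coordinate of real shape follows one of these, so
    [g, [g, g]] lives in the imaginary-shape coordinates of index >= 3, with
    purely imaginary values.  One more bracket annihilates everything: a real
    shape sees a vanishing real part, and an imaginary shape sees a coordinate
    of real shape (or of index 2), which is zero.  Thus the step is at most 3.
    It is 3 as soon as there is an imaginary shape at some m >= 3, that is for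
    n >= 3 in type I and n >= 4 in type II; in type II with n = 3 the only
    shape of index >= 3 is real, and the step is 2. *)

Set Implicit Arguments.
Unset Strict Implicit.
Unset Printing Implicit Defensive.

Import Order.TTheory GRing.Theory Num.Theory.
Local Open Scope ring_scope.
Local Open Scope complex_scope.

(** * Lower central series *)

Section LowerCentral.
Context {R : realType}.
Implicit Type g : lieAlgType R.

Lemma linear_vbasis_mem g (f : g -> g) (U W : {vspace g}) : linear f ->
  (forall X, X \in vbasis U -> f X \in W) -> forall X, X \in U -> f X \in W.
Proof.
move=> f_lin fW X /coord_vbasis ->.
pose fM := GRing.isLinear.Build R g g _ f f_lin.
pose fL : {linear g -> g} := HB.pack f fM.
rewrite -[f _]/(fL _) linear_sum rpred_sum // => i _.
by rewrite linearZ rpredZ // fW // mem_nth // size_tuple.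
Qed.

Lemma lieX0 g (X : g) : lie X 0 = 0.
Proof. by have := lie_linearr X (-1) 0 0; rewrite scaler0 addr0 scaleN1r addNr. Qed.

(** The definition of [liev] mentions the brackets of basis vectors only;
    bilinearity gives all the others. *)
Lemma mem_liev g (U V : {vspace g}) X Y :
  X \in U -> Y \in V -> lie X Y \in liev U V.
Proof.
move=> XU YV; move: X XU; apply: linear_vbasis_mem; first exact: lie_linearl.
move=> X XU; move: Y YV; apply: linear_vbasis_mem; first exact: lie_linearr.
by move=> Y YV; apply/memv_span/allpairs_f.
Qed.

(** Bounds [liev U V] from above by a linear condition given as a predicate. *)
Lemma liev_ind g (U V : {vspace g}) (P : g -> Prop) :
  P 0 -> (forall a X Y, P X -> P Y -> P (a *: X + Y)) ->
  (forall X Y, X \in U -> Y \in V -> P (lie X Y)) ->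
  forall Z, Z \in liev U V -> P Z.
Proof.
move=> P0 Plin Plie Z /(coord_span (X := in_tuple _)) ->.
apply: (big_ind P) => // [X Y PX PY|i _].
  by rewrite -[X]scale1r; apply: Plin.
rewrite -[_ *: _]addr0; apply: (Plin) => //=.
have := mem_nth 0 (ltn_ord i); rewrite /in_tuple /=.
move=> /allpairsP[[X Y] /= [XU YV ->]].
by apply: Plie; apply: vbasis_mem.
Qed.

Lemma liev_eq0 g (U V : {vspace g}) :
  (forall X Y, X \in U -> Y \in V -> lie X Y = 0) -> liev U V = 0%VS.
Proof.
move=> lie0; apply/eqP; rewrite -subv0; apply/subvP.
apply: liev_ind => [|a X Y X0 Y0|X Y XU YV]; first exact: mem0v.
  by rewrite rpredD // rpredZ.
by rewrite lie0 ?mem0v.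
Qed.

Lemma lower_central_eq0_le g j k : (j <= k)%N ->
  lower_central g j = 0%VS -> lower_central g k = 0%VS.
Proof.
move=> /subnK <-; elim: (k - j)%N => // d IHd /IHd /= ->.
by apply: liev_eq0 => X Y _; rewrite memv0 => /eqP->; exact: lieX0.
Qed.

Lemma nilpotency_stepS g k :
  lower_central g k.+1 = 0%VS -> lower_central g k <> 0%VS ->
  nilpotency_step g k.+1.
Proof.
move=> D0 Dn0; split=> // j lejk Dj; apply: Dn0.
exact: lower_central_eq0_le Dj.
Qed.

End LowerCentral.

(** * Coordinates *)

Section Coordinates.
Context {R : realType}.
Implicit Type g : lieAlgType R.
Local Notation C := R[i].
Local Notation Re := complex.Re.
Local Notation Im := complex.Im.

Definition is_k (b : bool) n g (J : 'End(g)) :=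
  if b then is_kI n J else is_kII n J.

(** A coframe seen as a complex-linear identification of g with C^n, through
    which the structure equations become formulas for the bracket. *)
Record k_coordinates (b : bool) n g (J : 'End(g)) (w : nat -> g -> C) : Prop :=
  KCoordinates {
    kc_linear : forall m (a : R) X Y, w m (a *: X + Y) = a%:C * w m X + w m Y;
    kc_J : forall m X, (1 <= m <= n)%N -> w m (J X) = 'i%C * w m X;
    kc_inj : forall X, (forall m, (1 <= m <= n)%N -> w m X = 0) -> X = 0;
    kc_surj : forall f : nat -> C, exists X,
      forall m, (1 <= m <= n)%N -> w m X = f m;
    kc_lie : forall m X Y, (1 <= m <= n)%N ->
      w m (lie X Y) = - Model.rhs b w m X Y
  }.

Lemma g10_of_real_is_linear g (J : 'End(g)) (l : {linear g -> R^o}) :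
  linear ((fun X => (l X : R) +i* - (l (J X) : R)) : g -> Rcomplex R).
Proof.
by move=> a X Y; rewrite !linearP /= opprD -mulrN.
Qed.

(** A nonzero X is not killed by some real linear form l, hence not by the
    (1,0)-form l - i l o J, which is a combination of the omega m. *)
Lemma basis10_separates n g (J : 'End(g)) (omega : nat -> cform g) X :
  (forall Y, J (J Y) = - Y) -> basis10 J n omega ->
  (forall m, (1 <= m <= n)%N -> omega m X = 0 :> C) -> X = 0.
Proof.
move=> JJ [_ span_omega _] omegaX0.
rewrite (coord_vbasis (memvf X)) big1 // => i _.
pose l : {linear g -> R^o} := coord (vbasis {:g}) i.
pose alphaM := GRing.isLinear.Build R g (Rcomplex R) _ _
  (g10_of_real_is_linear J l).
pose alpha : cform g := HB.pack (fun X => (l X : R) +i* - (l (J X) : R)) alphaM.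
have alphaJ : g10 J alpha.
  move=> Y; apply/eqP; rewrite /= JJ linearN opprK eq_complex /=.
  by apply/andP; split; apply/eqP; ring.
have [c /(_ X)] := span_omega alpha alphaJ.
rewrite big_nat big1 => [|m hm]; last by rewrite omegaX0 ?mulr0.
by move=> -[lX0 _]; rewrite -/(l X) lX0 scale0r.
Qed.

(** The coordinate map is injective between spaces of equal real dimension. *)
Lemma coframe_surjective n g (omega : nat -> cform g) f :
  (1 <= n)%N -> \dim {:g} = (2 * n)%N ->
  (forall X, (forall m, (1 <= m <= n)%N -> omega m X = 0 :> C) -> X = 0) ->
  exists X, forall m, (1 <= m <= n)%N -> omega m X = f m :> C.
Proof.
case: n => // n _ dimg sep.
(* The model serves as a concrete copy of the vector space C^n. *)
pose V := Model.kspace (R := R) true n.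
pose phi (X : g) : V := Model.kmk true n (fun m => omega m X).
have phi_lin : linear phi.
  move=> a X Y; apply: Model.kcoord_inj => m hm.
  rewrite Model.kcoordP /phi !Model.kcoord_mk // -Model.RcomplexZ.
  exact: (linearP (omega m)).
pose phiM := GRing.isLinear.Build R g V _ _ phi_lin.
pose phiL : {linear g -> V} := HB.pack phi phiM.
have ker0 : lker (linfun phiL) == 0%VS.
  rewrite -subv0; apply/subvP=> X; rewrite memv_ker lfunE /= memv0 => /eqP phiX0.
  apply/eqP/sep => m hm.
  by rewrite -[LHS](Model.kcoord_mk true (fun m => omega m X) hm)
    -/(phi X) phiX0 Model.kcoord0.
have imgT : limg (linfun phiL) = fullv.
  have capK : (fullv :&: lker (linfun phiL) = 0)%VS by rewrite (eqP ker0) capv0.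
  by apply/eqP; rewrite eqEdim subvf (limg_dim_eq capK) dimg
    (@Model.kdim R true n) /=.
have := memvf (Model.kmk true n f : V); rewrite -imgT => /memv_imgP[X _].
rewrite lfunE /= => fX; exists X => m hm.
by rewrite -(Model.kcoord_mk true f hm) fX Model.kcoord_mk.
Qed.

Lemma is_k_coordinates b n g (J : 'End(g)) : (1 <= n)%N ->
  is_k b n J -> exists w, k_coordinates b n J w.
Proof.
move=> n_gt0 kJ.
have [dimg [JJ _] [omega [omegaB domega]]] : [/\ \dim {:g} = (2 * n)%N,
    complex_structure J & exists omega : nat -> cform g, basis10 J n omega /\
    forall m, (1 <= m <= n)%N -> forall X Y,
    dform (omega m) X Y = Model.rhs b (fun i => omega i) m X Y].
  by case: b kJ.
have sep X := basis10_separates (X := X) JJ omegaB.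
have [omegaJ _ _] := omegaB.
exists (fun m => omega m); split=> //.
- by move=> m a X Y; rewrite -Model.RcomplexZ; exact: (linearP (omega m)).
- by move=> m X hm; apply: omegaJ.
- by move=> f; apply: (coframe_surjective f).
- by move=> m X Y hm; rewrite -domega // opprK.
Qed.

(** * Coordinates of brackets *)

Section Brackets.
Variables (b : bool) (n : nat) (g : lieAlgType R) (J : 'End(g)).
Variables (w : nat -> g -> C).
Hypothesis kw : k_coordinates b n J w.

Lemma kc0 m : w m 0 = 0.
Proof.
by have := kc_linear kw m (-1) 0 0; rewrite scaler0 addr0 rmorphN1 mulN1r addNr.
Qed.

Lemma lie_coord1 X Y : (1 <= n)%N -> w 1 (lie X Y) = 0.
Proof. by move=> hn; rewrite (kc_lie kw) //; case: b; rewrite oppr0. Qed.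

Lemma lie_coord2 X Y : (2 <= n)%N -> w 2 (lie X Y) =
  0 +i* (2 * (Re (w 1 X) * Im (w 1 Y) - Im (w 1 X) * Re (w 1 Y))).
Proof.
move=> hn; rewrite (kc_lie kw) //.
have -> : Model.rhs b w 2 X Y = wedge (w 1) (conjf (w 1)) X Y by case: b.
rewrite /wedge /conjf; case: (w 1 X) (w 1 Y) => [x x'] [y y'] /=.
by apply/eqP; rewrite eq_complex /=; apply/andP; split; apply/eqP; ring.
Qed.

Lemma lie_coord_im m X Y : (3 <= m <= n)%N -> b = odd m -> w m (lie X Y) =
  0 +i* (2 * (Re (w 1 X) * Re (w m.-1 Y) + Im (w 1 X) * Im (w m.-1 Y)
            - Re (w 1 Y) * Re (w m.-1 X) - Im (w 1 Y) * Im (w m.-1 X))).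
Proof.
case: m => [|[|[|m]]] // /andP[_ hm] bm; rewrite (kc_lie kw) //.
have -> : Model.rhs b w m.+3 X Y = im_form w m.+2 X Y.
  by rewrite bm /Model.rhs; case E: (odd m.+3); rewrite /rhsI /rhsII E.
rewrite /im_form /wedge /conjf /=.
case: (w 1 X) (w 1 Y) (w m.+2 X) (w m.+2 Y) => [x x'] [y y'] [z z'] [t t'] /=.
by apply/eqP; rewrite eq_complex /=; apply/andP; split; apply/eqP; ring.
Qed.

Lemma lie_coord_re m X Y : (3 <= m <= n)%N -> b = ~~ odd m -> w m (lie X Y) =
  (2 * Re (w m.-1 X))%:C * w 1 Y - (2 * Re (w m.-1 Y))%:C * w 1 X.
Proof.
case: m => [|[|[|m]]] // /andP[_ hm] bm; rewrite (kc_lie kw) //.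
have -> : Model.rhs b w m.+3 X Y = re_form w m.+2 X Y.
  by rewrite bm /Model.rhs if_neg; case E: (odd m.+3); rewrite /rhsI /rhsII E.
rewrite /re_form /wedge /conjf /=.
case: (w 1 X) (w 1 Y) (w m.+2 X) (w m.+2 Y) => [x x'] [y y'] [z z'] [t t'] /=.
by apply/eqP; rewrite eq_complex /=; apply/andP; split; apply/eqP; ring.
Qed.

(** The shapes alternate with opposite phases in the two types: for [m >= 3] the
    left case is the imaginary shape and the right case the real one. *)
Lemma type_parity m : {b = odd m} + {b = ~~ odd m}.
Proof. by case: b; case: (odd m); [left|right|right|left]. Qed.

Lemma lie_coord_eq0 m X Y : (1 <= m <= n)%N ->
  (forall i, (1 <= i < m)%N -> w i X = 0) -> w m (lie X Y) = 0.
Proof.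
case: m => [|[|[|m]]] // hm X0; first exact: lie_coord1.
  by rewrite lie_coord2 // X0 //= !mul0r subrr mulr0.
have h3 : (3 <= m.+3 <= n)%N by [].
case: (type_parity m.+3) => bm.
  by rewrite lie_coord_im //= !X0 //=; congr (_ +i* _); ring.
by rewrite lie_coord_re //= !X0 //= mulr0 rmorph0 mul0r mulr0 subrr.
Qed.

(** Since [w 1 X = 0] once [m >= 2], the bracket with Y only sees the real or
    the imaginary part of [w m X]; J exchanges the two up to sign, so the
    bracket of [J X] with Y provides the missing one. *)
Lemma lie_coord_predE m X Y : (1 <= m < n)%N ->
  w 1 Y = 'i%C -> (forall i, (1 < i <= n)%N -> w i Y = 0) ->
  (forall i, (1 <= i < m)%N -> w i X = 0) ->
  w m.+1 (lie X Y) = 0 -> w m.+1 (lie (J X) Y) = 0 -> w m X = 0.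
Proof.
move=> /andP[m_gt0 lt_mn] Y1 Y0 X0 h hJ.
have hm : (1 <= m <= n)%N by rewrite m_gt0 ltnW.
suff [re0 im0] : Re (w m X) = 0 /\ Im (w m X) = 0.
  by apply/eqP; rewrite eq_complex re0 im0 /= eqxx.
have JE : w m (J X) = - Im (w m X) +i* Re (w m X).
  rewrite (kc_J kw) //; case: (w m X) => x x' /=.
  by apply/eqP; rewrite eq_complex /=; apply/andP; split; apply/eqP; ring.
case: m => [|[|m]] // in hm m_gt0 lt_mn X0 h hJ JE *.
  move: h hJ; rewrite !lie_coord2 // JE Y1 /= => -[h] [hJ].
  by split; lra.
have h3 : (3 <= m.+3 <= n)%N by [].
have wYm : w m.+2 Y = 0 by rewrite Y0 // lt_mn ltnW.
have wX1 : w 1 X = 0 by rewrite X0.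
have wJX1 : w 1 (J X) = 0 by rewrite (kc_J kw) ?wX1 ?mulr0 //; lia.
move: h hJ; case: (type_parity m.+3) => bm.
  rewrite !lie_coord_im //= wX1 wJX1 wYm Y1 JE /= => -[h] [hJ].
  by split; lra.
rewrite !lie_coord_re //= wX1 wJX1 wYm Y1 JE /= => -[_ h] [_ hJ].
by split; lra.
Qed.

(** The ascending series gains one coordinate per step, starting from the
    last one. *)
Lemma in_ascP k X :
  in_asc J k X <-> (forall i, (1 <= i <= n - k)%N -> w i X = 0).
Proof.
elim: k X => [|k IHk] X /=.
  by split=> [-> i _|X0]; [exact: kc0 | apply: (kc_inj kw); rewrite -(subn0 n)].
split=> [[aX aJX]|X0]; last first.
  split=> Y; apply/IHk => m hm; apply: lie_coord_eq0; try lia;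
    move=> i hi; rewrite ?(kc_J kw) ?X0 ?mulr0 //; lia.
have [Y Y_e1] := kc_surj kw (fun i => if i == 1 then 'i%C else 0).
elim/ltn_ind=> i IHi hi.
have hi1 : (1 <= i.+1 <= n - k)%N by lia.
apply: (lie_coord_predE (Y := Y)).
- lia.
- by rewrite Y_e1 //; lia.
- by move=> j /andP[j_gt1 lejn]; rewrite Y_e1 ?lejn 1?ltnW // gtn_eqF.
- by move=> j hj; apply: IHi; lia.
- exact: (IHk _).1 (aX Y) _ hi1.
- exact: (IHk _).1 (aJX Y) _ hi1.
Qed.

Lemma asc_full_n : asc_full J n.
Proof. by move=> X; apply/in_ascP; lia. Qed.

Lemma asc_full_ge_n s : asc_full J s -> (n <= s)%N.
Proof.
move=> fullJ; rewrite leqNgt; apply/negP=> lt_sn.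
have [X X1] := kc_surj kw (fun=> 1).
have h1 : (1 <= 1 <= n)%N by lia.
have := X1 1%N h1; rewrite ((in_ascP s X).1 (fullJ X)); last by lia.
by move/eqP; rewrite eq_sym oner_eq0.
Qed.

(** * Nilpotency step *)

Lemma Re_coord_linear m a X Y :
  Re (w m (a *: X + Y)) = a * Re (w m X) + Re (w m Y).
Proof.
by rewrite (kc_linear kw); case: (w m X) (w m Y) => [x x'] [y y'] /=; ring.
Qed.

(** The indices [m = 2] and [b = odd m] are those at which the structure
    equation takes purely imaginary values. *)
Lemma commutator_coords X : (1 <= n)%N -> X \in lower_central g 1 ->
  w 1 X = 0 /\
  forall m, (2 <= m <= n)%N -> m = 2 \/ b = odd m -> Re (w m X) = 0.
Proof.
move=> n_ge1; move: X; apply: liev_ind => [|a Y Z [Y1 Ym] [Z1 Zm]|Y Z _ _].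
- by split=> [|m _ _]; rewrite kc0.
- split=> [|m hm im]; first by rewrite (kc_linear kw) Y1 Z1 mulr0 addr0.
  by rewrite Re_coord_linear Ym // Zm // mulr0 addr0.
- split=> [|m hm]; first exact: lie_coord1.
  case: (m =P 2) hm => [-> hm _|m2 hm [//|bm]]; first by rewrite lie_coord2.
  by rewrite lie_coord_im //; lia.
Qed.

Lemma double_commutator_coords X : (1 <= n)%N -> X \in lower_central g 2 ->
  [/\ w 1 X = 0, forall m, (2 <= m <= n)%N -> Re (w m X) = 0
    & forall m, (2 <= m <= n)%N -> m = 2 \/ b = ~~ odd m -> w m X = 0].
Proof.
move=> n_ge1; move: X.
apply: liev_ind => [|a Y Z [Y1 YR Ym] [Z1 ZR Zm]|Y Z _ ZD].
- by split=> *; rewrite kc0.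
- split=> [|m hm|m hm bm]; rewrite ?Re_coord_linear ?(kc_linear kw).
  + by rewrite Y1 Z1 mulr0 addr0.
  + by rewrite YR // ZR // mulr0 addr0.
  + by rewrite Ym // Zm // mulr0 addr0.
have [Z1 ZR] := commutator_coords n_ge1 ZD.
have lie0 m : (2 <= m <= n)%N -> m = 2 \/ b = ~~ odd m -> w m (lie Y Z) = 0.
  case: (m =P 2) => [-> hm _|m2 hm [//|bm]].
    by rewrite lie_coord2 // Z1 /= !mulr0 subrr mulr0.
  (* The preceding index is 2 or of imaginary shape. *)
  have ZR' : Re (w m.-1 Z) = 0.
    apply: ZR; first by lia.
    by right; rewrite bm; case: (m) hm => //= p _; rewrite negbK.
  by rewrite lie_coord_re ?Z1 ?ZR' ?mulr0 ?rmorph0 ?mul0r ?subrr //; lia.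
split=> // [|m hm]; first exact: lie_coord1.
case: (m =P 2) => [m2|m2]; first by rewrite lie0 //; left.
case: (type_parity m) => bm; first by rewrite lie_coord_im //; lia.
by rewrite lie0 //; right.
Qed.

Lemma lower_central3 : (1 <= n)%N -> lower_central g 3 = 0%VS.
Proof.
move=> n_ge1; apply: liev_eq0 => X Y _ YD.
have [Y1 YR Ym] := double_commutator_coords n_ge1 YD.
apply/(kc_inj kw) => -[|[|[|m]]] // hm; first exact: lie_coord1.
  by rewrite lie_coord2 // Y1 /= !mulr0 subrr mulr0.
have hm' : (2 <= m.+2 <= n)%N by lia.
case: (type_parity m.+3) => bm; last first.
  by rewrite lie_coord_re //= Y1 YR // !mulr0 rmorph0 mul0r subrr.
have Y' : w m.+2 Y = 0 by apply: Ym => //; right; rewrite bm /= negbK.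
by rewrite lie_coord_im //= Y1 Y' /= !(mulr0, mul0r, addr0, subr0).
Qed.

Lemma lower_central2_mem X Y Z : lie X (lie Y Z) \in lower_central g 2.
Proof. by do !apply: mem_liev; rewrite ?memvf. Qed.

Lemma lower_central2_neq0 m X Y Z : (1 <= m <= n)%N ->
  Im (w m (lie X (lie Y Z))) != 0 -> lower_central g 2 <> 0%VS.
Proof.
move=> hm neq0 D0; have := lower_central2_mem X Y Z.
by rewrite D0 memv0 => /eqP XYZ0; rewrite XYZ0 kc0 eqxx in neq0.
Qed.

(** With [w 1 A = 1] and [w 1 B = i] the coordinate of index 2 of [A, B] is
    2i, which the imaginary shape at index 3 detects. *)
Lemma typeI_lower_central2_neq0 : b = true -> (3 <= n)%N ->
  lower_central g 2 <> 0%VS.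
Proof.
move=> bT n_ge3.
have [A A_e1] := kc_surj kw (fun i => (i == 1)%:R).
have [B B_ie1] := kc_surj kw (fun i => if i == 1 then 'i%C else 0).
apply: (@lower_central2_neq0 3 B A B) => //.
rewrite lie_coord_im //= lie_coord1 ?lie_coord2 ?A_e1 ?B_ie1 //=; try lia.
by rewrite !(mulr0, mul0r, mulr1, mul1r, addr0, add0r, subr0) mulf_neq0 ?pnatr_eq0.
Qed.

(** With [w 1 A = 1] and [w 2 B = 1] the real shape at index 3 gives [A, B] a
    nonzero coordinate, which the imaginary shape at index 4 detects. *)
Lemma typeII_lower_central2_neq0 : b = false -> (4 <= n)%N ->
  lower_central g 2 <> 0%VS.
Proof.
move=> bF n_ge4.
have [A A_e1] := kc_surj kw (fun i => (i == 1)%:R).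
have [B B_e2] := kc_surj kw (fun i => (i == 2)%:R).
apply: (@lower_central2_neq0 4 A A B) => //.
rewrite lie_coord_im //= lie_coord1 ?lie_coord_re ?A_e1 ?B_e2 //=; try lia.
rewrite !(mulr0, mul0r, mulr1, mul1r, addr0, add0r, subr0, sub0r, oppr0).
by rewrite mulf_neq0 ?oppr_eq0 ?pnatr_eq0.
Qed.

(** Index 3 is of real shape here, so no coordinate of [g, [g, g]]
    survives. *)
Lemma typeII_lower_central2_eq0 : b = false -> n = 3 ->
  lower_central g 2 = 0%VS.
Proof.
move=> bF n3; apply/eqP; rewrite -subv0; apply/subvP => X XD.
have [|X1 _ Xm] := double_commutator_coords _ XD; first by rewrite n3.
rewrite memv0; apply/eqP/(kc_inj kw); rewrite n3 => -[|[|[|[|m]]]] // _.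
  by apply: Xm; [rewrite n3 | left].
by apply: Xm; [rewrite n3 | right; rewrite bF].
Qed.

(** With [w 1 A = 1] and [w 1 B = i] the coordinate of index 2 of [A, B] is
    2i. *)
Lemma lower_central1_neq0 : (2 <= n)%N -> lower_central g 1 <> 0%VS.
Proof.
move=> n_ge2 D0.
have [A A_e1] := kc_surj kw (fun i => (i == 1)%:R).
have [B B_ie1] := kc_surj kw (fun i => if i == 1 then 'i%C else 0).
have : lie A B \in lower_central g 1 by apply: mem_liev; rewrite memvf.
rewrite D0 memv0 => /eqP AB0.
have := lie_coord2 A B n_ge2; rewrite AB0 kc0 A_e1 ?B_ie1 /=; try lia.
move=> -[]; lra.
Qed.

End Brackets.

(** * Conclusion for both types *)

Lemma is_k_dimC b n g (J : 'End(g)) : is_k b n J -> dimC g = n.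
Proof.
by case: b => -[dimg _ _]; rewrite /dimC dimg mul2n doubleK.
Qed.

Lemma is_k_MaxN b n g (J : 'End(g)) : (1 <= n)%N -> is_k b n J -> MaxN J.
Proof.
move=> n_ge1 kJ; have [w kw] := is_k_coordinates n_ge1 kJ.
have csJ : complex_structure J by case: b kJ {kw} => -[].
split; first by exists 3; exact: (lower_central3 kw).
  by split=> //; exists n; exact: (asc_full_n kw).
rewrite (is_k_dimC kJ); split; first exact: (asc_full_n kw).
by move=> s lt_sn /(asc_full_ge_n kw); rewrite leqNgt lt_sn.
Qed.

Lemma is_k_step3 b n g (J : 'End(g)) : (3 + ~~ b <= n)%N -> is_k b n J ->
  nilpotency_step g 3.
Proof.
move=> n_ge kJ; have n_ge1 : (1 <= n)%N by lia.
have [w kw] := is_k_coordinates n_ge1 kJ.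
apply: nilpotency_stepS; first exact: (lower_central3 kw).
case: b kJ kw n_ge => kJ kw n_ge.
  exact: (typeI_lower_central2_neq0 kw).
exact: (typeII_lower_central2_neq0 kw).
Qed.

Lemma is_kII3_step2 g (J : 'End(g)) : is_k false 3 J -> nilpotency_step g 2.
Proof.
move=> kJ; have [//|w kw] := is_k_coordinates _ kJ.
apply: nilpotency_stepS; first exact: (typeII_lower_central2_eq0 kw).
exact: (lower_central1_neq0 kw).
Qed.

End Coordinates.

Theorem proposition4p1 (R : realType) :
  (forall (n : nat) (g : lieAlgType R) (J : 'End(g)),
     (1 <= n)%N -> is_kI n J -> MaxN J) /\
  (forall (n : nat) (g : lieAlgType R) (J : 'End(g)),
     (1 <= n)%N -> is_kII n J -> MaxN J) /\
  (forall (n : nat) (g : lieAlgType R) (J : 'End(g)),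
     (4 <= n)%N -> is_kI n J -> nilpotency_step g 3) /\
  (forall (n : nat) (g : lieAlgType R) (J : 'End(g)),
     (4 <= n)%N -> is_kII n J -> nilpotency_step g 3) /\
  (forall (g : lieAlgType R) (J : 'End(g)),
     is_kI 3 J -> nilpotency_step g 3) /\
  (forall (g : lieAlgType R) (J : 'End(g)),
     is_kII 3 J -> nilpotency_step g 2).
Proof.
split; first by move=> n g J; apply: (is_k_MaxN (b := true)).
split; first by move=> n g J; apply: (is_k_MaxN (b := false)).
split; first by move=> n g J n_ge4; apply: (is_k_step3 (b := true)); apply: ltnW.
split; first by move=> n g J; apply: (is_k_step3 (b := false)).
split; first by move=> g J; apply: (is_k_step3 (b := true)).
by move=> g J; apply: is_kII3_step2.
Qed.
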